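(* Let $L$ be a lobster where $v_1,v_2,\dots,v_n$ are the vertices on the spine of $L$, with degrees $d_1,d_2,\dots,d_n$, respectively. Let $d_{n+1},d_{n+2},\dots,d_{n+k}$ be the degrees of the non-pendant vertices that are not on the spine but are adjacent to a vertex on the spine. Let $d_1',d_2',\dots,d_n'$ be the numbers of non-pendant vertices adjacent to $v_1,v_2,\dots,v_n$, respectively, and let $d'=\max\{d_1',d_2',\dots,d_n'\}$. If \[ \sum_{i=1}^{n+k}(d_i-2)+2\;\ge\;\sum_{i=1}^n (d'-d_i'), \] then $L$ is neighborhood-prime.
   Context: All graphs are finite and simple; $[N]=\{1,\dots,N\}$; $N(v)$ is the set of neighbors of $v$. A neighborhood-prime labeling of a graph $G$ of order $N$ is a bijection $f:V(G)\to[N]$ such that for every vertex $v$ of degree greater than $1$, $\gcd\{f(u):u\in N(v)\}=1$; a graph is neighborhood-prime if it has such a labeling. A lobster is a tree containing a path, called the spine, such that every vertex of the tree is within distance $2$ of the spine. A pendant vertex is a vertex of degree $1$. *)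

(* Defs.v *)
From mathcomp Require Import all_boot all_order all_algebra.

Set Implicit Arguments.
Unset Strict Implicit.
Unset Printing Implicit Defensive.

(* MathComp world: a graph is an edge relation [e] on a finType of vertices. *)

Definition simple_graph (T : finType) (e : rel T) : Prop :=
  symmetric e /\ irreflexive e.

Definition neighbors (T : finType) (e : rel T) (v : T) : {set T} :=
  [set u | e v u].

Definition degree (T : finType) (e : rel T) (v : T) : nat :=
  #|neighbors e v|.

Definition pendant (T : finType) (e : rel T) (v : T) : bool :=
  degree e v == 1.

(* A simple cycle [c] is given without repeating its first vertex, so the
   sequences of size at most 2 satisfying [ucycle e] are not graph cycles. *)
Definition acyclic (T : finType) (e : rel T) : Prop :=
  forall c : seq T, ucycle e c -> size c <= 2.

Definition is_tree (T : finType) (e : rel T) : Prop :=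
  [/\ 0 < #|T|, forall u v : T, connect e u v & acyclic e].

Definition within_distance (T : finType) (e : rel T) (k : nat) (u v : T)
    : Prop :=
  exists p : seq T, [/\ path e u p, last u p = v & size p <= k].

(* [sorted e s] says that consecutive members of [s] are adjacent; [sorted]
   carries no order here. *)
Definition is_path (T : finType) (e : rel T) (s : seq T) : Prop :=
  [/\ s != [::], sorted e s & uniq s].

Definition is_spine (T : finType) (e : rel T) (s : seq T) : Prop :=
  is_path e s /\
  forall v : T, exists2 u : T, u \in s & within_distance e 2 v u.

Definition lobster (T : finType) (e : rel T) : Prop :=
  is_tree e /\ exists s : seq T, is_spine e s.

Definition nonpendant_degree (T : finType) (e : rel T) (v : T) : nat :=
  #|[set u in neighbors e v | ~~ pendant e u]|.

Definition max_nonpendant_degree (T : finType) (e : rel T) (s : seq T) : nat :=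
  \max_(v <- s) nonpendant_degree e v.

Definition off_spine (T : finType) (e : rel T) (s : seq T) : {set T} :=
  [set v | [&& v \notin s, ~~ pendant e v & [exists u in s, e u v]]].

Definition neighborhood_prime_labeling (T : finType) (e : rel T)
    (f : T -> nat) : Prop :=
  [/\ injective f,
      forall k : nat, (exists v : T, f v = k) <-> 1 <= k <= #|T|
    & forall v : T, 1 < degree e v ->
        \big[gcdn/0]_(u in neighbors e v) f u = 1].

Definition neighborhood_prime (T : finType) (e : rel T) : Prop :=
  exists f : T -> nat, neighborhood_prime_labeling e f.

(* Main.v *)
Require Import Defs.
From mathcomp Require Import all_boot all_order all_algebra.
From mathcomp Require Import zify ring lra.

(** A vertex is satisfied as soon as two of its neighbours carry coprime
    labels, so it suffices to choose one pair of neighbours for each vertex of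
    degree at least 2 and to make all these pairs coprime.

    Let the spine be v_0, ..., v_(n-1) with n >= 2.  An interior spine vertex
    v_(i+1) uses the pair v_i, v_(i+2).  The other vertices of degree at least 2
    are the off-spine non-pendant vertices and the non-pendant ends of the
    spine; call them anchors.  An anchor has a neighbour on the spine (its
    parent) and one off the spine (its child), and it uses this pair.  In a tree
    an off-spine vertex has at most one neighbour among the spine and the
    anchors ([skeleton_neighbor_unique], because an edge of a tree is a bridge),
    so distinct anchors have distinct children.  If the spine is read in the
    order v_0, v_2, v_4, ..., v_1, v_3, ..., the problem becomes one about
    numbers ([allocation]): find centres c_0, ..., c_(n-1), consecutive ones
    coprime, and for each child a label coprime to the centre of its parent, all
    these labels being distinct members of [1, N]; the remaining vertices
    receive the remaining labels ([labeling_of_allocation]).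

    Counting degrees, the hypothesis of the theorem implies that
    N >= n (d' - 1) + 2.  There are two regimes.

    If N >= 11 n, everything is greedy ([allocation_sparse]).  At most about
    half of the labels outside the spine go to children, so a centre is harmless
    when it is coprime to a bit more than half of [1, N].  For N < 1700 the
    primes are numerous enough to serve as centres.  For larger N an averaging
    argument over the numbers coprime to 6 shows that most of them share a
    factor with few others; these are harmless, and each is coprime to at least
    n of them, so that a chain of centres can be extended step by step.

    If N < 11 n, then d' is at most 11.  The centre of v_0 is 1, which is
    coprime to everything, and the other spine vertices receive consecutive
    blocks of labels: if d' >= 3, of length d' - 1, d' or d' + 1, according to
    the number of their interior neighbours on the spine, and of length at most
    3 otherwise ([neighborhood_prime_of_blocks]).  The centre of a block is
    coprime to the whole block, and the children of its vertex are labelled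
    inside the block.  Only the primes 2, 3, 5 and 7 matter at such short
    distances, so the existence of the centres is a finite computation modulo
    these four primes ([steps_okT]).

    A spine with a single vertex is simpler: that vertex gets the label 1, which
    satisfies all the others. *)

Set Implicit Arguments.
Unset Strict Implicit.
Unset Printing Implicit Defensive.
Import GRing.Theory Num.Theory.

(** * Numbers coprime to 6 and their common factors *)

Definition count6 (N : nat) : nat := count (coprime^~ 6) (iota 1 N).

Lemma count6D6 N : count6 (N + 6) = count6 N + 2.
Proof.
rewrite /count6 iotaD count_cat; congr (_ + _).
have E k : coprime (1 + N + k) 6 = coprime (1 + N %% 6 + k) 6.
  rewrite -coprime_modl -(coprime_modl (1 + N %% 6 + k)).
  by rewrite -modnDml -(modnDmr 1 N) modnDml.
have : N %% 6 < 6 by rewrite ltn_mod.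
rewrite (_ : iota (1 + N) 6 = [seq 1 + N + k | k <- iota 0 6]); last first.
  by rewrite [X in map X](_ : _ = addn (1 + N)) // -iotaDl addn0.
rewrite count_map (eq_count (a2 := fun k => coprime (1 + N %% 6 + k) 6)); last first.
  by move=> k /=; rewrite E.
by case: (N %% 6) => [|[|[|[|[|[|]]]]]].
Qed.

Lemma count6_bounds N :
  [/\ N <= 3 * count6 N + 1, 3 * count6 N <= N + 2 & N <= 4 * count6 N].
Proof.
rewrite (divn_eq N 6) addnC; have : N %% 6 < 6 by rewrite ltn_mod.
set r := N %% 6; elim: (N %/ 6) => [|a IH] hr.
  by rewrite mul0n addn0; move: hr; case: r => [|[|[|[|[|[|]]]]]].
rewrite mulSn (addnC 6) addnA count6D6; case: (IH hr) => *; split; lia.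
Qed.

Lemma count_multiples (a a' : pred nat) p N :
  0 < p -> (forall y, a (y * p) -> a' y) ->
  count (fun x => (p %| x) && a x) (iota 1 N) <= count a' (iota 1 (N %/ p)).
Proof.
move=> p0 h; rewrite -!size_filter.
set s := filter _ _; rewrite -(size_map (fun x => x %/ p) s).
apply: uniq_leq_size.
  rewrite map_inj_in_uniq ?filter_uniq ?iota_uniq // => x y.
  rewrite !mem_filter => /andP[/andP[/dvdnP[x' ->] _] _].
  by move=> /andP[/andP[/dvdnP[y' ->] _] _]; rewrite !mulnK // => ->.
move=> z /mapP[x]; rewrite mem_filter => /andP[/andP[/dvdnP[y ->] ay] hy] ->.
rewrite mulnK // mem_filter /= h //=; move: hy; rewrite !mem_iota => hy.
have : y <= N %/ p by rewrite leq_divRL //; lia.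
by case: y ay hy => [|y] ay hy; lia.
Qed.

(** An upper bound for the number of x <= N coprime to 6 that are not coprime
    to c: each of them is a multiple of a prime factor p of c, and its quotient
    by p is again coprime to 6. *)
Definition weight (N c : nat) : nat :=
  \sum_(5 <= p < N.+1 | prime p && (p %| c)) count6 (N %/ p).

(** Union bound over the primes that can divide a common factor of x and c;
    none of them is 2 or 3, as c is coprime to 6. *)
Lemma count_noncoprime (a : pred nat) N c :
  0 < c <= N -> coprime c 6 ->
  count (fun x => a x && ~~ coprime x c) (iota 1 N) <=
  \sum_(5 <= p < N.+1 | prime p && (p %| c))
     count (fun x => (p %| x) && a x) (iota 1 N).
Proof.
move=> /andP[c0 cN] c6.
rewrite -sum1_count big_mkcond /=.
under [X in _ <= X]eq_bigr => p _ do rewrite -sum1_count big_mkcond /=.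
rewrite exchange_big /=; apply: leq_sum => x _.
case: ifP => // /andP[ax nxc].
set g := gcdn x c; set p := pdiv g.
have g1 : 1 < g.
  have: 0 < g by rewrite gcdn_gt0 c0 orbT.
  by move: nxc; rewrite /coprime -/g; lia.
have pp : prime p by apply: pdiv_prime.
have px : p %| x by apply: dvdn_trans (pdiv_dvd g) (dvdn_gcdl _ _).
have pc : p %| c by apply: dvdn_trans (pdiv_dvd g) (dvdn_gcdr _ _).
have pN : p <= N by apply: leq_trans (dvdn_leq c0 pc) cN.
have p6 : coprime p 6 by apply: coprime_dvdl pc c6.
have p5 : 4 < p.
  by clear -pp p6; case: p pp p6 => [|[|[|[|[|[]]]]]].
rewrite (big_rem p) /=; last by rewrite mem_index_iota; lia.
by rewrite pp pc px ax.
Qed.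

Lemma noncoprime6_weight N c : 0 < c <= N -> coprime c 6 ->
  count (fun x => coprime x 6 && ~~ coprime x c) (iota 1 N) <= weight N c.
Proof.
move=> cN c6; apply: leq_trans (count_noncoprime _ cN c6) _.
apply: leq_sum => p /andP[pp _]; apply: count_multiples; first exact: prime_gt0.
by move=> y; rewrite coprimeMl => /andP[].
Qed.

Lemma noncoprime_weight N c : 0 < c <= N -> coprime c 6 ->
  count (fun x => ~~ coprime x c) (iota 1 N) <= 4 * weight N c.
Proof.
move=> cN c6; apply: leq_trans (count_noncoprime predT cN c6) _.
rewrite /weight big_distrr /=; apply: leq_sum => p /andP[pp _].
apply: leq_trans (count_multiples (a' := predT) _ (prime_gt0 pp) _) _ => //.
by rewrite count_predT size_iota; case: (count6_bounds (N %/ p)).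
Qed.

(** Exchanging the sums, each prime p is counted once for every c <= N coprime
    to 6 that it divides, that is at most [count6 (N %/ p)] times. *)
Lemma sum_weight N :
  \sum_(c <- iota 1 N | coprime c 6) weight N c <=
  \sum_(5 <= p < N.+1 | prime p) count6 (N %/ p) ^ 2.
Proof.
rewrite /weight.
under eq_bigr => c _ do rewrite big_mkcondr /=.
rewrite exchange_big /=; apply: leq_sum => p pp.
rewrite -big_mkcondr /= big_const_seq iter_addn_0 leq_mul2l.
apply/orP; right.
rewrite (eq_count (a2 := fun x => (p %| x) && coprime x 6)); last first.
  by move=> x /=; rewrite andbC.
apply: count_multiples; first exact: prime_gt0.
by move=> y; rewrite coprimeMl => /andP[].
Qed.

(** The two numbers coprime to 6 in a period of length 6 contribute less to the
    sum of the inverse squares than the decrease of a telescoping bound. *)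
Lemma inv_sq_step (R : realFieldType) (x : R) : (0 <= x ->
  ((6%:R * x + 5%:R) ^+ 2)^-1 + ((6%:R * x + 7%:R) ^+ 2)^-1 <=
  (9%:R * (2%:R * x + 1))^-1 - (9%:R * (2%:R * x + 3%:R))^-1)%R.
Proof.
move=> x0; rewrite -subr_ge0.
have -> : ((9%:R * (2%:R * x + 1))^-1 - (9%:R * (2%:R * x + 3%:R))^-1 -
  (((6%:R * x + 5%:R) ^+ 2)^-1 + ((6%:R * x + 7%:R) ^+ 2)^-1) =
  (12%:R * (6%:R * x + 6%:R) ^+ 2 + 20%:R) /
  (9%:R * (2%:R * x + 1) * (2%:R * x + 3%:R) * (6%:R * x + 5%:R) ^+ 2 *
   (6%:R * x + 7%:R) ^+ 2))%R.
  field; do ?[apply/andP; split]; lra.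
by apply: divr_ge0; nra.
Qed.

Lemma sum_inv_sq (R : realFieldType) J :
  (\sum_(5 <= d < 6 * J + 5 | coprime d 6) ((d%:R : R) ^+ 2)^-1 <=
   9%:R^-1 - (9%:R * (2%:R * J%:R + 1))^-1 :> R)%R.
Proof.
elim: J => [|J IH]; first by rewrite big_geq // mulr0 add0r mulr1 subrr.
rewrite (_ : 6 * J.+1 + 5 = (6 * J + 5).+1.+1.+1.+1.+1.+1); last by lia.
have E k : coprime (6 * J + k) 6 = coprime k 6.
  by rewrite -coprime_modl mulnC modnMDl coprime_modl.
rewrite big_mkcond; do 6 (rewrite big_nat_recr /=; last by lia).
rewrite -big_mkcond /= -!addnS !E /= !addr0.
have D k : ((6 * J + k)%:R = 6%:R * J%:R + k%:R :> R)%R by rewrite natrD natrM.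
have := inv_sq_step (ler0n R J); rewrite !D -[J.+1]addn1 natrD.
rewrite (_ : 2%:R * (J%:R + 1%:R) + 1 = 2%:R * J%:R + 3%:R :> R)%R; last by ring.
move: IH; lra.
Qed.

Lemma sum_div_sq_field (R : realFieldType) N :
  9 * \sum_(5 <= d < N.+1 | coprime d 6) (N %/ d) ^ 2 <= N ^ 2.
Proof.
case: (leqP 5 N.+1) => [hN|hN]; last by rewrite big_geq ?muln0 // ltnW.
rewrite -(ler_nat R) natrM natr_sum.
have h : (\sum_(5 <= d < N.+1 | coprime d 6) ((N %/ d) ^ 2)%:R <=
  N%:R ^+ 2 * \sum_(5 <= d < 6 * N + 5 | coprime d 6) ((d%:R : R) ^+ 2)^-1
  :> R)%R.
  rewrite big_distrr /= [X in (_ <= X)%R](@big_cat_nat _ _ _ N.+1) /=; first last.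
  - by lia.
  - exact: hN.
  rewrite -[X in (X <= _)%R]addr0; apply: lerD; last first.
    by apply: sumr_ge0 => d _; rewrite mulr_ge0 ?invr_ge0 ?exprn_ge0 ?ler0n.
  rewrite big_nat_cond [X in (_ <= X)%R]big_nat_cond.
  apply: ler_sum => d /andP[/andP[d5 _] _].
  rewrite natrX -exprVn -exprMn; apply: lerXn2r; rewrite ?nnegrE ?ler0n //.
    by rewrite mulr_ge0 ?invr_ge0 ?ler0n.
  rewrite ler_pdivlMr ?ltr0n; last by lia.
  by rewrite -natrM ler_nat leq_trunc_div.
have := sum_inv_sq R N; set S := (\sum_(5 <= d < _ | _) _)%R in h *.
set S' := (\sum_(5 <= d < _ | _) _)%R in h * => hS.
have p0 : (0 <= (9%:R * (2%:R * N%:R + 1))^-1 :> R)%R.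
  by rewrite invr_ge0 -natrM natr1 -natrM ler0n.
have n0 : (0 <= N%:R ^+ 2 :> R)%R by rewrite exprn_ge0 ?ler0n.
rewrite natrX; nra.
Qed.

Lemma sum_div_sq N :
  9 * \sum_(5 <= d < N.+1 | coprime d 6) (N %/ d) ^ 2 <= N ^ 2.
Proof. exact: (sum_div_sq_field rat). Qed.

(** Markov's inequality for [weight].  The square of f + 2 is bounded by
    13/12 f ^ 2 + 52, which trades the additive errors of [count6_bounds] for a
    slightly larger main term and a term linear in N. *)
Lemma bad_centers N :
  N * count (fun c => coprime c 6 && (N < 9 * weight N c)) (iota 1 N) * 108 <=
  13 * N ^ 2 + 12 * 9 * 52 * count6 N.
Proof.
have h1 : N * count (fun c => coprime c 6 && (N < 9 * weight N c)) (iota 1 N) <=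
  9 * \sum_(c <- iota 1 N | coprime c 6) weight N c.
  rewrite -sum1_count big_distrr /= big_distrr /= big_mkcondr /=.
  by apply: leq_sum => c _; case: ifP => // /ltnW; rewrite muln1.
have h2 : 9 * \sum_(5 <= p < N.+1 | prime p) count6 (N %/ p) ^ 2 <=
   \sum_(5 <= p < N.+1 | coprime p 6) (N %/ p + 2) ^ 2.
  rewrite big_distrr /= big_mkcond [X in _ <= X]big_mkcond /=.
  rewrite big_nat_cond [X in _ <= X]big_nat_cond.
  apply: leq_sum => p /andP[/andP[p5 _] _]; case: ifP => // pp.
  rewrite (_ : coprime p 6); last first.
    rewrite prime_coprime //; apply/negP => p6; have := dvdn_leq (isT : 0 < 6) p6.
    by clear -p5 pp p6; case: p p5 pp p6 => [|[|[|[|[|[|[|]]]]]]].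
  have [_ h _] := count6_bounds (N %/ p).
  by rewrite (_ : 9 * _ = (3 * count6 (N %/ p)) ^ 2) ?leq_sqr //; lia.
have h3 : 12 * \sum_(5 <= p < N.+1 | coprime p 6) (N %/ p + 2) ^ 2 <=
  13 * \sum_(5 <= p < N.+1 | coprime p 6) (N %/ p) ^ 2 + 12 * 52 * count6 N.
  have -> : count6 N = \sum_(1 <= p < N.+1 | coprime p 6) 1.
    by rewrite /count6 -sum1_count /index_iota subn1.
  have : \sum_(5 <= p < N.+1 | coprime p 6) 1 <=
         \sum_(1 <= p < N.+1 | coprime p 6) 1.
    case: (leqP 5 N.+1) => hN; last by rewrite big_geq // ltnW.
    by rewrite [X in _ <= X](@big_cat_nat _ _ _ 5) //= leq_addl.
  move=> h; apply: leq_trans (leq_add (leqnn _) (leq_mul (leqnn _) h)).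
  rewrite !big_distrr -big_split /=; apply: leq_sum => p _.
  (* (f - 24) ^ 2 >= 0 *)
  by have := (nat_Cauchy (N %/ p) 24).1; move: (N %/ p) => f; nia.
have h4 := sum_weight N; have h5 := sum_div_sq N.
move: h1 h2 h3 h4 h5.
set a := N * _; set b := \sum_(c <- _ | _) _; set c := \sum_(5 <= p < _ | prime p) _.
set d := \sum_(5 <= p < _ | _) _; set e := \sum_(5 <= p < _ | _) _.
lia.
Qed.

(** * Many labels: a greedy choice *)

Lemma fresh_element (T : eqType) (a : pred T) (G c : seq T) :
  uniq G -> size c < count a G -> exists x, [/\ x \in G, a x & x \notin c].
Proof.
move=> uG hc; case: (boolP (all (mem c) (filter a G))) => [/allP sub|/allPn[x]].
  by move: hc; rewrite ltnNge -size_filter uniq_leq_size ?filter_uniq.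
by rewrite mem_filter => /andP[ax xG] xc; exists x.
Qed.

(** Greedy: the last vertex of a path with fewer than n vertices is coprime to
    a member of G that the path does not contain. *)
Lemma coprime_path (G : seq nat) (n : nat) :
  uniq G -> n <= size G -> (forall c, c \in G -> n <= count (coprime c) G) ->
  exists c, [/\ size c = n, uniq c, {subset c <= G} & sorted coprime c].
Proof.
move=> uG nG hG; suff H k : k <= n ->
    exists c, [/\ size c = k, uniq c, {subset c <= G} & sorted coprime c].
  exact: H.
elim: k => [_|k IH kn]; first by exists [::].
have [[|x c] [sc uc cG pc]] := IH (ltnW kn).
  have [] := @fresh_element _ predT G [::] uG.
    by rewrite count_predT (leq_trans _ nG) //=; lia.
  move=> y [yG _ _]; exists [:: y]; split=> //=; first by rewrite -sc.
  by move=> z; rewrite inE => /eqP ->.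
have xG : x \in G by apply: cG; rewrite mem_head.
have [|y [yG cxy yc]] := @fresh_element _ (coprime x) G (x :: c) uG.
  by rewrite sc; apply: leq_trans kn (hG _ xG).
exists (y :: x :: c); split=> //=.
- by rewrite -sc.
- by rewrite yc.
- by move=> z; rewrite inE => /predU1P[->|/cG].
- by rewrite coprime_sym cxy.
Qed.

(** The labels are chosen from the last row to the first.  A row r has to avoid
    F and the labels already taken by the later rows, and only the rows in
    conflict with r can have taken a label that r allows. *)
Lemma greedy_labels (al : nat -> seq nat) (conf : rel nat) (F rows : seq nat) :
  (forall r, uniq (al r)) ->
  (forall r r' x, x \in al r -> x \in al r' -> conf r r') ->
  (forall p r q, rows = p ++ r :: q ->
     count (mem F) (al r) + count (conf r) q < size (al r)) ->
  exists lab, [/\ all2 (fun l r => l \in al r) lab rows, uniq lab &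
                  {in lab, forall l, l \notin F}].
Proof.
move=> ual hconf; elim: rows => [|r q IH] hcount; first by exists [::].
have [|lab [hlab ulab labF]] := IH.
  by move=> p r' q' e; apply: (hcount (r :: p)); rewrite e.
have hq : count (mem lab) (al r) <= count (conf r) q.
  apply: (@leq_trans (count (mem (al r)) lab)).
    rewrite -!size_filter uniq_leq_size ?filter_uniq // => x.
    by rewrite !mem_filter => /andP[? ?]; apply/andP.
  elim: (lab) (q) hlab => [|l ls IHl] [|r' q'] //= /andP[lr' h].
  apply: leq_add (IHl _ h).
  by case: (boolP (l \in al r)) => // lr; rewrite (hconf _ _ _ lr lr').
have [] := @fresh_element _ predT (al r) (filter (mem (F ++ lab)) (al r)) (ual r).
  rewrite count_predT size_filter; apply: leq_trans (hcount [::] r q erefl).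
  rewrite ltnS (eq_count (a2 := predU (mem F) (mem lab))); last first.
    by move=> x /=; rewrite mem_cat.
  apply: leq_trans (leq_add (leqnn _) hq).
  by rewrite -count_predUI leq_addr.
move=> x [xr _]; rewrite mem_filter xr andbT /= mem_cat negb_or => /andP[xF xlab].
exists (x :: lab); split=> /=; rewrite ?xr ?xlab //.
by move=> z; rewrite inE => /predU1P[->|/labF].
Qed.

(** [rows] lists, for each child, the position of its parent; [c] lists the
    labels of the spine, in the order chosen for it, and [lab] those of the
    children. *)
Definition allocation (N n : nat) (rows c lab : seq nat) : Prop :=
  [/\ size c = n, uniq (c ++ lab), {in c ++ lab, forall x, 0 < x <= N},
      sorted coprime c & all2 (fun l r => coprime l (nth 0 c r)) lab rows].

(** A set G of admissible centres is enough if every member is coprime to n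
    members of G, to continue the chain, and to as many labels as there are
    centres and children, to choose the labels of the children. *)
Lemma allocation_good N n rows (G : seq nat) :
  uniq G -> {in G, forall x, 0 < x <= N} -> n <= size G ->
  (forall c, c \in G -> n <= count (coprime c) G) ->
  (forall c, c \in G -> n + size rows <= count (coprime^~ c) (iota 1 N)) ->
  {in rows, forall r, r < n} ->
  exists c lab, allocation N n rows c lab.
Proof.
move=> uG GN nG G1 G2 rn.
have [c [sc uc cG pc]] := coprime_path uG nG G1.
pose al r := if r < n then filter (coprime^~ (nth 0 c r)) (iota 1 N) else [::].
have [||p r q e|lab [hlab ulab labF]] := @greedy_labels al (fun _ _ => true) c rows.
- by move=> r; rewrite /al; case: ifP => // _; rewrite filter_uniq ?iota_uniq.
- by [].
- have rn' : r < n by apply: rn; rewrite e mem_cat mem_head orbT.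
  rewrite /al rn' size_filter count_predT.
  apply: leq_trans (G2 (nth 0 c r) _); last by apply: cG; rewrite mem_nth ?sc.
  rewrite e size_cat /= -addnS leq_add //; last by lia.
  rewrite -sc -size_filter uniq_leq_size ?filter_uniq ?iota_uniq // => x.
  by rewrite mem_filter => /andP[].
exists c, lab; split=> //.
- rewrite cat_uniq uc ulab andbT; apply/hasPn => x /labF; by [].
- move=> x; rewrite mem_cat => /orP[/cG/GN //|xl].
  elim: (lab) (rows) xl hlab {ulab labF} => [|l ls IH] [|r q] //=.
  rewrite inE => /predU1P[->|xl] /andP[lr h]; last exact: IH h.
  move: lr; rewrite /al; case: ifP => // _.
  by rewrite mem_filter mem_iota => /andP[_]; lia.
- elim: (lab) (rows) hlab {rn G2 ulab labF} => [|l ls IH] [|r q] //= /andP[lr h].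
  rewrite IH // andbT; move: lr; rewrite /al; case: ifP => // _.
  by rewrite mem_filter => /andP[].
Qed.

(** [acc] is the number of primes from 5 to N - 1, so that k consecutive bounds
    are tested in one pass. *)
Fixpoint enough_primes (k N acc : nat) : bool :=
  if k is k'.+1 then
    let acc' := (4 < N) && prime N + acc in
    ((N < 20) || (N + 11 <= 11 * acc')) && enough_primes k' N.+1 acc'
  else true.

Lemma enough_primesP N : 20 <= N < 1700 ->
  N + 11 <= 11 * count (fun p => (4 < p) && prime p) (iota 1 N).
Proof.
move=> hN; set a := fun p => _.
have H k M acc : enough_primes k M.+1 acc -> acc = count a (iota 1 M) ->
    forall N, M < N <= M + k -> 20 <= N -> N + 11 <= 11 * count a (iota 1 N).
  elim: k M acc => [|k IH] M acc; first by move=> _ _ N' ?; lia.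
  rewrite [enough_primes _ _ _]/= => /andP[h1 h2] hacc N' hN' N20.
  set acc' := _ + acc in h1 h2.
  have hacc' : acc' = count a (iota 1 M.+1).
    by rewrite -(addn1 M) iotaD count_cat /= addn0 -hacc addnC.
  case: (ltngtP N' M.+1) => hN''; [by lia| |].
    by apply: (IH M.+1 acc' h2 hacc') => //; lia.
  by move: h1; rewrite hN'' -hacc'; lia.
have E : enough_primes 1700 1 0 by vm_compute.
by apply: (H 1700 0 0 E erefl); lia.
Qed.

Lemma count_coprime_prime N p : prime p -> 4 < p ->
  4 * N <= 5 * count (coprime^~ p) (iota 1 N).
Proof.
move=> pp p5.
have := count_predC (coprime^~ p) (iota 1 N); rewrite size_iota.
have : count (predC (coprime^~ p)) (iota 1 N) <= N %/ p.
  rewrite (eq_count (a2 := fun x => (p %| x) && true)); last first.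
    by move=> x; rewrite /= coprime_sym prime_coprime // negbK andbT.
  apply: leq_trans (count_multiples (a' := predT) _ (prime_gt0 pp) _) _ => //.
  by rewrite count_predT size_iota.
have : N %/ p <= N %/ 5 by apply: leq_div2l.
have := leq_trunc_div N 5; lia.
Qed.

(** For N < 1700 the centres are primes.  Otherwise they are the c coprime to 6
    with 9 weight N c <= N: about N / 3 numbers are coprime to 6, at most about
    13 N / 108 of them are excluded, each remaining one fails to be coprime to
    at most N / 9 of them, and 1/3 - 13/108 - 1/9 exceeds 1/11; for N >= 1700
    the difference also absorbs the lower order terms.  Such a c is coprime to
    at least 5 N / 9 of the labels. *)
Theorem allocation_sparse N n rows :
  2 <= n -> 11 * n <= N -> 2 * size rows + n <= N + 4 ->
  {in rows, forall r, r < n} ->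
  exists c lab, allocation N n rows c lab.
Proof.
move=> n2 nN hD hrows.
case: (ltnP N 1700) => N0.
  pose G := filter (fun p => (4 < p) && prime p) (iota 1 N).
  have sG : n < size G.
    by rewrite size_filter; have := @enough_primesP N; lia.
  have Gp p : p \in G -> [/\ prime p, 4 < p & 0 < p <= N].
    by rewrite mem_filter mem_iota => /andP[/andP[-> ->]]; split=> //; lia.
  apply: (@allocation_good N n rows G) => //.
  - by rewrite filter_uniq ?iota_uniq.
  - by move=> p /Gp[].
  - exact: ltnW.
  - move=> p /[dup] pG /Gp[pp _ _].
    have := count_predC (coprime p) G.
    have : count (predC (coprime p)) G <= size [:: p].
      rewrite -size_filter uniq_leq_size ?filter_uniq ?iota_uniq // => x.
      rewrite mem_filter => /andP[/= npx /Gp[px _ _]].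
      by rewrite prime_coprime // negbK dvdn_prime2 // eq_sym in npx; rewrite inE.
    by move=> /=; lia.
  - move=> p /Gp[pp p5 _]; have := count_coprime_prime N pp p5; lia.
pose good c := coprime c 6 && (9 * weight N c <= N).
pose G := filter good (iota 1 N).
have Gp c : c \in G -> [/\ coprime c 6, 0 < c <= N & 9 * weight N c <= N].
  by rewrite mem_filter mem_iota => /andP[/andP[-> ->]]; split=> //; lia.
have [b1 b2 _] := count6_bounds N.
have hG c : c \in G -> n <= count (coprime c) G.
  move=> /Gp[c6 cN wc]; have := noncoprime6_weight cN c6.
  have := bad_centers N.
  set bad := count _ _; set nc := count _ _ => hbad hnc.
  have : count6 N <= bad + nc + count (coprime c) G.
    rewrite /count6 /bad /nc /G count_filter; elim: (iota 1 N) => //= x l.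
    rewrite /good [coprime x c]coprime_sym.
    by case: (coprime x 6) => //=; case: (leqP (9 * weight N x) N);
       case: (coprime c x) => /=; lia.
  nia.
apply: (@allocation_good N n rows G) => //.
- by rewrite filter_uniq ?iota_uniq.
- by move=> p /Gp[].
- have G1 : 1 \in G.
    rewrite mem_filter mem_iota /good /weight big1 /=; first by lia.
    by move=> p /andP[pp]; rewrite dvdn1 => /eqP p1; rewrite p1 in pp.
  exact: leq_trans (hG _ G1) (count_size _ _).
- move=> c /Gp[c6 cN wc]; have := noncoprime_weight cN c6.
  have : count (coprime^~ c) (iota 1 N) +
      count (fun x => ~~ coprime x c) (iota 1 N) = N.
    by rewrite -[RHS](size_iota 1 N) -(count_predC (coprime^~ c)).
  lia.
Qed.

(** * Few labels: centres of consecutive blocks *)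

(** When g has no prime factor other than 2, 3, 5, 7, the residues of a modulo
    these primes determine whether a and a + g are coprime. *)
Record residues := Residues { mod2 : nat; mod3 : nat; mod5 : nat; mod7 : nat }.

Definition residues_of (a : nat) : residues :=
  Residues (a %% 2) (a %% 3) (a %% 5) (a %% 7).

Definition shift (r : residues) (l : nat) : residues :=
  Residues ((mod2 r + l) %% 2) ((mod3 r + l) %% 3)
           ((mod5 r + l) %% 5) ((mod7 r + l) %% 7).

(** A sufficient test for a + i to be coprime to g, hence to a + i + g and
    a + i - g, where r lists the residues of a.  For g < 24 the excluded values
    are 0 and those with a prime factor other than 2, 3, 5, 7. *)
Definition coprime_gap (r : residues) (i g : nat) : bool :=
  if (2 %| g) && (2 %| mod2 r + i) then false else
  if (3 %| g) && (3 %| mod3 r + i) then false else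
  if (5 %| g) && (5 %| mod5 r + i) then false else
  if (7 %| g) && (7 %| mod7 r + i) then false else
  g \notin [:: 0; 11; 13; 17; 19; 22; 23].

Definition dist (i j : nat) : nat := (i - j) + (j - i).

(** The centre at position i of a block of length l is coprime to the rest of
    the block.  In a short block it is also coprime to the number after the
    block: otherwise the chain can be blocked by short blocks that follow and
    leave little choice. *)
Definition good_center (r : residues) (l i : nat) : bool :=
  [&& i < l, all (fun j => (j == i) || coprime_gap r i (dist i j)) (iota 0 l)
    & (6 < l) || coprime_gap r i (l - i)].

Definition good_centers (r : residues) (l : nat) : seq nat :=
  [seq i <- iota 0 l | good_center r l i].

(** A block of length l contains a good centre, and each of its good centres is
    coprime to some good centre of the next block, whatever the length of that
    block.  Lengths are between b and b + 2 for a fixed b <= 10, hence at most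
    12, and consecutive ones differ by at most 2. *)
Definition step_ok (r : residues) (l : nat) : bool :=
  let g := good_centers r l in
  (g != [::]) &&
  all (fun l' => let g' := good_centers (shift r l) l' in
         all (fun i => has (fun i' => coprime_gap r i (l - i + i')) g') g)
      [seq l' <- iota (l - 2) 5 | 0 < l' <= 12].

Definition steps_ok : bool :=
  all (fun l => all (fun r2 => all (fun r3 => all (fun r5 => all (fun r7 =>
    step_ok (Residues r2 r3 r5 r7) l) (iota 0 7)) (iota 0 5)) (iota 0 3))
    (iota 0 2)) (iota 1 12).

Lemma steps_okT : steps_ok.
Proof. by vm_compute. Qed.

Lemma coprime_gapP a i g : g < 24 ->
  coprime_gap (residues_of a) i g -> coprime (a + i) g.
Proof.
move=> g24; rewrite /coprime_gap /=.
have D p : (p %| a %% p + i) = (p %| a + i) by rewrite /dvdn modnDml.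
rewrite !D; case: ifPn => // h2; case: ifPn => // h3; case: ifPn => // h5.
case: ifPn => // h7 hg.
have g0 : 0 < g by case: (g) hg.
rewrite /coprime eqn_leq gcdn_gt0 g0 orbT andbT leqNgt; apply/negP => /pdiv_prime.
set p := pdiv _ => pp.
have pa : p %| a + i by apply: dvdn_trans (pdiv_dvd _) (dvdn_gcdl _ _).
have pg : p %| g by apply: dvdn_trans (pdiv_dvd _) (dvdn_gcdr _ _).
have : all (fun g => (g \in [:: 0; 11; 13; 17; 19; 22; 23]) ||
         all (fun p => p \in [:: 2; 3; 5; 7]) (primes g)) (iota 0 24) by [].
move=> /allP/(_ g); rewrite mem_iota (negPf hg) /= => /(_ g24)/allP/(_ p).
rewrite mem_primes pp g0 pg => /(_ isT); rewrite !inE.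
by case/or4P => /eqP e; move: h2 h3 h5 h7; rewrite -?e pa pg.
Qed.

Lemma residues_ofD a l : shift (residues_of a) l = residues_of (a + l).
Proof. by rewrite /shift /residues_of /= !modnDml. Qed.

Lemma step_okP a l : 0 < l <= 12 -> step_ok (residues_of a) l.
Proof.
move=> hl; have /allP h := steps_okT.
have {h}/allP h := h l ltac:(by rewrite mem_iota).
have {h}/allP h := h (a %% 2) ltac:(by rewrite mem_iota /= ltn_mod).
have {h}/allP h := h (a %% 3) ltac:(by rewrite mem_iota /= ltn_mod).
have {h}/allP h := h (a %% 5) ltac:(by rewrite mem_iota /= ltn_mod).
by apply: h; rewrite mem_iota /= ltn_mod.
Qed.

Lemma good_center_coprime a l i j : l <= 12 ->
  good_center (residues_of a) l i -> j < l -> j != i -> coprime (a + j) (a + i).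
Proof.
move=> l12 /and3P[il /allP h _] jl ji.
have := h j; rewrite mem_iota (negPf ji) /= => /(_ jl) /coprime_gapP hc.
have {hc} : coprime (a + i) (dist i j) by apply: hc; rewrite /dist; lia.
rewrite /dist /coprime; case: (ltngtP i j) ji => // ij _.
- rewrite (_ : i - j + (j - i) = j - i) => [hg|]; last by lia.
  by rewrite gcdnC (_ : a + j = a + i + (j - i)) ?gcdnDl //; lia.
- rewrite (_ : i - j + (j - i) = i - j); last by lia.
  rewrite {1}(_ : a + i = a + j + (i - j)); last by lia.
  rewrite gcdnC gcdnDr => hg.
  by rewrite (_ : a + i = a + j + (i - j)) ?gcdnDl 1?gcdnC //; lia.
Qed.

Fixpoint in_blocks (a : nat) (ls cs : seq nat) : Prop :=
  match ls, cs with
  | [::], [::] => True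
  | l :: ls', c :: cs' =>
      [/\ a <= c < a + l,
          forall x, a <= x < a + l -> x != c -> coprime x c &
          in_blocks (a + l) ls' cs']
  | _, _ => False
  end.

Lemma chain_blocks_from b ls a l i : 0 < b <= 10 ->
  all (fun l => b <= l <= b + 2) ls -> b <= l <= b + 2 ->
  good_center (residues_of a) l i ->
  exists2 cs, in_blocks (a + l) ls cs & path coprime (a + i) cs.
Proof.
move=> hb; elim: ls a l i => [|l' ls IH] a l i /=; first by exists [::].
move=> /andP[hl' hls] hl gi.
have /andP[_ /allP h] := @step_okP a l ltac:(lia).
have {h}/allP/(_ i) := h l' ltac:(rewrite mem_filter mem_iota; lia).
have il : i < l by case/and3P: gi.
rewrite mem_filter gi mem_iota => /(_ il)/hasP[i'].
rewrite residues_ofD mem_filter => /andP[gi' _] /coprime_gapP hc.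
have il' : i' < l' by case/and3P: gi'.
have {}hc : coprime (a + i) (a + l + i').
  rewrite (_ : a + l + i' = a + i + (l - i + i')); last by lia.
  by rewrite /coprime gcdnDl; apply: hc; lia.
have [cs h1 h2] := IH _ _ _ hls hl' gi'.
exists (a + l + i' :: cs); last by rewrite /= hc.
split=> //; first by lia.
move=> x hx xi; rewrite (_ : x = a + l + (x - (a + l))); last by lia.
by apply: good_center_coprime gi' _ _ => //; [lia|lia|move: xi; lia].
Qed.

Lemma chain_blocks b ls a : 0 < b <= 10 ->
  all (fun l => b <= l <= b + 2) ls ->
  exists2 cs, in_blocks a ls cs & sorted coprime cs.
Proof.
move=> hb; case: ls => [|l ls] /=; first by exists [::].
move=> /andP[hl hls]; have /andP[] := @step_okP a l ltac:(lia).
rewrite -has_filter => /hasP[i]; rewrite mem_iota => il gi _.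
have [cs h1 h2] := chain_blocks_from hb hls hl gi.
exists (a + i :: cs) => //; split=> //; first by lia.
move=> x hx xi; rewrite (_ : x = a + (x - a)); last by lia.
by apply: good_center_coprime gi _ _ => //; [lia|lia|move: xi; lia].
Qed.

Lemma in_blocksP a ls cs : in_blocks a ls cs ->
  size cs = size ls /\ forall r, r < size ls ->
    let s := a + sumn (take r ls) in
    s <= nth 0 cs r < s + nth 0 ls r /\
    forall x, s <= x < s + nth 0 ls r -> x != nth 0 cs r ->
      coprime x (nth 0 cs r).
Proof.
elim: ls a cs => [|l ls IH] a [|c cs] //= [hc hx /IH[-> h]].
by split=> // -[|r] /= hr; [rewrite addn0 | rewrite addnA; apply: h].
Qed.

Lemma block_start_mono a ls r r' : r < r' <= size ls ->
  a + sumn (take r ls) + nth 0 ls r <= a + sumn (take r' ls).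
Proof.
elim: ls r r' => [|l ls IH] [|r] [|r'] /= hr; rewrite ?take0 /=; try lia.
by have := IH r r' hr; lia.
Qed.

(** The centre at position 0 is 1, and the following positions own consecutive
    blocks starting at 2.  The children of position 0 accept any label; they
    come first in the list of rows, hence are served last, when it suffices
    that N labels are available in total.  The other children stay in the block
    of their row, where they compete only with each other. *)
Theorem allocation_blocks N n b ls rows0 rows1 :
  n = (size ls).+1 -> 0 < b <= 10 -> all (fun l => b <= l <= b + 2) ls ->
  1 + sumn ls <= N -> n + size (rows0 ++ rows1) <= N ->
  all (pred1 0) rows0 -> {in rows1, forall r, 0 < r < n} ->
  (forall r, r < size ls -> count_mem r.+1 rows1 < nth 0 ls r) ->
  exists c lab, allocation N n (rows0 ++ rows1) c lab.
Proof.
move=> en hb hls hN hD h0 h1 hcap.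
have [cs /in_blocksP[scs hcs] pcs] := chain_blocks 2 hb hls.
pose s r := 2 + sumn (take r ls).
have s2 r : 2 <= s r by rewrite /s.
have mono r r' : r < r' -> r' <= size ls -> s r + nth 0 ls r <= s r'.
  by move=> *; apply: block_start_mono; apply/andP.
have sN r : r < size ls -> s r + nth 0 ls r <= N.+1.
  by move=> /mono/(_ (leqnn _)); rewrite {2}/s take_size; lia.
have disj r r' x : r < size ls -> r' < size ls ->
    s r <= x < s r + nth 0 ls r -> s r' <= x < s r' + nth 0 ls r' -> r = r'.
  move=> hr hr' hx hx'; case: (ltngtP r r') => // h.
    by have := mono _ _ h (ltnW hr'); lia.
  by have := mono _ _ h (ltnW hr); lia.
have csP r : r < size ls -> s r <= nth 0 cs r < s r + nth 0 ls r.
  by move=> /hcs[].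
pose c := 1 :: cs.
have uc : uniq c.
  rewrite /= andbC; apply/andP; split.
    apply/(uniqP 0) => r r'; rewrite !inE scs => hr hr' e.
    by apply: (disj r r' (nth 0 cs r)); rewrite // ?csP // e csP.
  apply/negP => /(nthP 0)[r]; rewrite scs => hr e.
  by have := csP _ hr; rewrite e /s; lia.
pose al r := if r is r'.+1 then
    [seq x <- iota (s r') (nth 0 ls r') | x != nth 0 cs r'] else iota 1 N.
pose conf r r' := [|| r == r', r == 0 | r' == 0].
have alP r x : r < size ls -> x \in al r.+1 ->
    s r <= x < s r + nth 0 ls r /\ x != nth 0 cs r.
  by move=> _; rewrite /= mem_filter mem_iota => /andP[].
pose al' r := if r < n then al r else [::].
have [|||lab [hlab ulab labF]] := @greedy_labels al' conf c (rows0 ++ rows1).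
- move=> r; rewrite /al'; case: ifP => // _.
  by case: r => [|r]; rewrite ?iota_uniq // filter_uniq ?iota_uniq.
- move=> [|r] [|r'] x //; rewrite /al' en !ltnS.
  case: ifP => // hr; case: ifP => // hr' /(alP _ _ hr)[h _] /(alP _ _ hr')[h' _].
  by rewrite /conf eqSS (disj _ _ _ hr hr' h h') eqxx.
- move=> p r q e.
  case: r e => [|r] e.
    rewrite /al' en /= size_iota.
    have := count_size (conf 0) q.
    have : count (mem c) (iota 1 N) <= n.
      rewrite -size_filter (_ : n = size c); last by rewrite /= scs.
      apply: uniq_leq_size; rewrite ?filter_uniq ?iota_uniq // => x.
      by rewrite mem_filter => /andP[].
    move: hD; rewrite e size_cat /=; lia.
  have [p' e'] : exists p', rows1 = p' ++ r.+1 :: q.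
    elim: (rows0) (p) h0 e => [|r0 rs IH] [|p0 ps] //=.
    - by move=> _ ->; exists [::].
    - by move=> _ ->; exists (p0 :: ps).
    - by move=> /andP[/eqP -> _].
    - by move=> /andP[_ h] [_]; apply: IH.
  have q1 x : x \in q -> 0 < x.
    move=> xq; have := h1 x.
    by rewrite e' mem_cat inE xq !orbT => /(_ isT)/andP[].
  have rn : r < size ls.
    by have := h1 r.+1; rewrite e' mem_cat mem_head orbT en => /(_ isT).
  rewrite /al' en ltnS rn.
  have -> : count (mem c) (al r.+1) = 0.
    apply/eqP; rewrite -leqn0 leqNgt -has_count.
    apply/hasPn => x /(alP _ _ rn)[hx xr].
    rewrite /= inE negb_or; apply/andP; split; first by rewrite /s in hx; lia.
    apply/negP => /(nthP 0)[r']; rewrite scs => hr' ex.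
    have hx' := csP _ hr'; rewrite ex in hx'.
    by rewrite (disj _ _ _ rn hr' hx hx') ex eqxx in xr.
  have -> : count (conf r.+1) q = count_mem r.+1 q.
    apply: eq_in_count => x /q1 x0; rewrite /conf /=; lia.
  have : count (predC (fun x => x != nth 0 cs r)) (iota (s r) (nth 0 ls r)) <= 1.
    rewrite (eq_count (a2 := pred1 (nth 0 cs r))); last by move=> x /=; rewrite negbK.
    by rewrite (count_uniq_mem _ (iota_uniq _ _)); case: (_ \in _).
  have := count_predC (fun x => x != nth 0 cs r) (iota (s r) (nth 0 ls r)).
  have := hcap _ rn; rewrite e' count_cat /= eqxx size_iota size_filter; lia.
have labP x : x \in lab -> 0 < x <= N.
  move=> xl; have /hasP[r _] : has (fun r => x \in al' r) (rows0 ++ rows1).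
    elim: (lab) (rows0 ++ rows1) hlab xl {ulab labF} => [|l ls' IH] [|r q] //=.
    move=> /andP[lr h]; rewrite inE => /predU1P[->|xl]; first by rewrite lr.
    by rewrite (IH q h xl) orbT.
  rewrite /al'; case: ifP => //; case: r => [|r] hr; first by rewrite mem_iota; lia.
  have hr' : r < size ls by rewrite en in hr.
  move=> /(alP _ _ hr')[hx _]; have := sN _ hr'; have := s2 r; move: hx; clear.
  by move: (s r) (nth 0 ls r); lia.
exists c, lab; split.
- by rewrite /= scs.
- rewrite cat_uniq uc ulab andbT; apply/hasPn => x /labF; by [].
- move=> x; rewrite mem_cat => /orP[|/labP //].
  rewrite inE => /predU1P[->|]; first by lia.
  move=> /(nthP 0)[r]; rewrite scs => hr <-; have := csP _ hr; have := sN _ hr.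
  by have := s2 r; move: (s r) (nth 0 cs r) (nth 0 ls r); lia.
- by rewrite /=; case: (cs) pcs => //= a l ->; rewrite coprime1n.
- elim: (lab) (rows0 ++ rows1) hlab {ulab labF labP hD}
    => [|l ls' IH] [|r q] //= /andP[lr h].
  rewrite IH // andbT; move: lr; rewrite /al'; case: ifP => //.
  case: r => [|r] hr; first by rewrite /= coprimen1.
  have hr' : r < size ls by rewrite en in hr.
  by move=> /(alP _ _ hr')[hx xr]; apply: (hcs _ hr').2.
Qed.

(** * Labellings and the order of the spine *)

Lemma gcd_coprime (T : finType) (A : {set T}) (f : T -> nat) x y :
  x \in A -> y \in A -> coprime (f x) (f y) -> \big[gcdn/0]_(u in A) f u = 1.
Proof.
move=> xA yA /eqP cxy; apply/eqP; rewrite -dvdn1 -cxy dvdn_gcd.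
by rewrite (bigD1 x xA) dvdn_gcdl /= -(bigD1 x xA) (bigD1 y yA) dvdn_gcdl.
Qed.

(** The remaining vertices are matched with the remaining labels. *)
Lemma extend_labeling (T : finType) (xs : seq T) (ls : seq nat) :
  uniq xs -> uniq ls -> size xs = size ls -> {in ls, forall k, 0 < k <= #|T|} ->
  exists f : T -> nat,
    [/\ injective f, forall k, (exists v, f v = k) <-> 1 <= k <= #|T|
      & forall x0 t, t < size xs -> f (nth x0 xs t) = nth 0 ls t].
Proof.
move=> uxs uls ss hls.
pose xs' := xs ++ [seq x <- enum T | x \notin xs].
pose ls' := ls ++ [seq k <- iota 1 #|T| | k \notin ls].
have ux : uniq xs'.
  rewrite cat_uniq uxs filter_uniq ?enum_uniq // andbT.
  by apply/hasPn => x; rewrite mem_filter => /andP[].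
have ul : uniq ls'.
  rewrite cat_uniq uls filter_uniq ?iota_uniq // andbT.
  by apply/hasPn => x; rewrite mem_filter => /andP[].
have mx x : x \in xs' by rewrite mem_cat mem_filter mem_enum andbT orbN.
have ml k : (k \in ls') = (0 < k <= #|T|).
  rewrite mem_cat mem_filter mem_iota add1n ltnS.
  by case: (boolP (k \in ls)) => [/hls ->|].
have sx : size xs' = #|T|.
  by rewrite -(card_uniqP ux); apply: eq_card => x; rewrite mx.
have sl : size ls' = #|T|.
  rewrite -(size_iota 1 #|T|); apply: perm_size; apply: uniq_perm => //.
    exact: iota_uniq.
  by move=> k; rewrite ml mem_iota add1n ltnS.
have ix x : index x xs' < #|T| by rewrite -sx index_mem.
exists (fun x => nth 0 ls' (index x xs')); split.
- move=> x y /eqP; rewrite nth_uniq ?sl // => /eqP e.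
  by rewrite -(nth_index x (mx x)) e nth_index.
- move=> k; split=> [[v <-]|].
    by have := mem_nth 0 (_ : index v xs' < size ls'); rewrite sl ml => ->.
  rewrite -ml => kl; have hk : index k ls' < size xs' by rewrite sx -sl index_mem.
  case: (xs') sx ux hk => [|x0 xs0] sx' ux' hk //.
  by exists (nth x0 (x0 :: xs0) (index k ls')); rewrite index_uniq // nth_index.
- move=> x0 t ht; have -> : nth x0 xs t = nth x0 xs' t by rewrite nth_cat ht.
  rewrite index_uniq // ?nth_cat -?ss ?ht //.
  by rewrite size_cat ltn_addr.
Qed.

(** In this order the indices i and i + 2 are consecutive. *)
Definition alternate (n : nat) : seq nat :=
  [seq k.*2 | k <- iota 0 (uphalf n)] ++ [seq k.*2.+1 | k <- iota 0 n./2].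

Definition alternate_pos (n i : nat) : nat := i./2 + odd i * uphalf n.

Lemma size_alternate n : size (alternate n) = n.
Proof. by rewrite size_cat !size_map !size_iota; lia. Qed.

Lemma alternate_pos_lt n i : i < n -> alternate_pos n i < n.
Proof. by rewrite /alternate_pos; case: (odd i) (odd_double_half i); lia. Qed.

Lemma nth_alternate_pos n i : i < n -> nth 0 (alternate n) (alternate_pos n i) = i.
Proof.
move=> hi; rewrite /alternate_pos nth_cat size_map size_iota.
have := odd_double_half i; case: (odd i) => /= hi2.
  rewrite mul1n ltnNge leq_addl /= addnK (nth_map 0) ?size_iota; last by lia.
  by rewrite nth_iota; lia.
rewrite mul0n addn0 (_ : i./2 < uphalf n); last by lia.
by rewrite (nth_map 0) ?size_iota ?nth_iota; lia.
Qed.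

Lemma mem_alternate n i : (i \in alternate n) = (i < n).
Proof.
apply/idP/idP => [|hi]; last first.
  rewrite -[X in X \in _](nth_alternate_pos hi) mem_nth // size_alternate.
  exact: alternate_pos_lt.
by rewrite mem_cat => /orP[] /mapP[k]; rewrite mem_iota; lia.
Qed.

Lemma perm_alternate n : perm_eq (alternate n) (iota 0 n).
Proof.
have h : alternate n =i iota 0 n by move=> i; rewrite mem_alternate mem_iota.
apply: uniq_perm => //; rewrite ?(eq_uniq _ h) ?iota_uniq //.
by rewrite size_alternate size_iota.
Qed.

Lemma uniq_alternate n : uniq (alternate n).
Proof. by rewrite (perm_uniq (perm_alternate n)) iota_uniq. Qed.

Lemma alternate_posK n j : j < n -> alternate_pos n (nth 0 (alternate n) j) = j.
Proof.
move=> hj; have hn : nth 0 (alternate n) j < n.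
  by rewrite -mem_alternate mem_nth ?size_alternate.
apply/eqP; rewrite -(nth_uniq 0 _ _ (uniq_alternate n)) ?size_alternate //.
  by rewrite nth_alternate_pos.
exact: alternate_pos_lt.
Qed.

Lemma alternate_posSS n i : alternate_pos n i.+2 = (alternate_pos n i).+1.
Proof. by rewrite /alternate_pos /= negbK. Qed.

(** * Spines of trees *)

Section Spine.

Variables (T : finType) (e : rel T) (s : seq T).
Hypothesis esym : symmetric e.
Hypothesis eirr : irreflexive e.
Hypothesis eacyc : acyclic e.
Hypothesis spine : is_spine e s.

Let neq x y : e x y -> x != y.
Proof. by apply: contraTneq => ->; rewrite eirr. Qed.

Definition cut (x y : T) : rel T :=
  [rel a b | e a b && ~~ (((a == x) && (b == y)) || ((a == y) && (b == x)))].

(** A path from x to y avoiding the edge would close up to a cycle. *)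
Lemma bridge x y : e x y -> ~~ connect (cut x y) x y.
Proof.
move=> exy; apply/negP => /connectP[p pp ly].
move: pp ly => /shortenP[p' pp' up' _] ly.
have pe : path e x p' by apply: sub_path pp' => a b /andP[].
have := eacyc (c := x :: p').
rewrite /ucycle up' /cycle rcons_path pe -ly esym exy => /(_ isT).
case: p' pp' ly {up' pe} => [|z [|]] //=; first by move=> _ xy; rewrite xy eirr in exy.
by move=> /andP[/andP[_ h] _] zy; rewrite zy !eqxx in h.
Qed.

Lemma cut_sym x y : connect_sym (cut x y).
Proof.
apply: sym_connect_sym => a b; rewrite /cut /= esym; congr (_ && ~~ _).
by rewrite orbC; congr (_ || _); rewrite andbC.
Qed.

Lemma cut_edge x y a b : e a b -> a != x -> b != x -> connect (cut x y) a b.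
Proof.
move=> eab ax bx; apply: connect1; rewrite /cut /= eab (negPf ax) (negPf bx).
by rewrite andbF.
Qed.

Lemma spine_connect x y a b :
  x \notin s -> a \in s -> b \in s -> connect (cut x y) a b.
Proof.
have [[_ ps _] _] := spine.
case: s ps => [|v l] //= pl xs as_ bs.
have pc : path (cut x y) v l.
  apply: (@sub_in_path _ (mem (v :: l)) e) pl; last by apply/allP.
  move=> c d cs ds; rewrite /cut /= => ->.
  have -> : c == x = false by apply: contraNF xs => /eqP <-.
  have -> : d == x = false by apply: contraNF xs => /eqP <-.
  by rewrite andbF.
have h := path_connect pc.
by apply: connect_trans (h _ bs); rewrite cut_sym; apply: h.
Qed.

(* Contains the spine and all the vertices of degree at least 2. *)
Let skeleton w := (w \in s) || (w \in off_spine e s).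

Lemma off_spineP w :
  reflect [/\ w \notin s, ~~ pendant e w & exists2 a, a \in s & e w a]
    (w \in off_spine e s).
Proof.
rewrite inE; apply: (iffP and3P) => -[h1 h2]; last first.
  by move=> [a ha ea]; split=> //; apply/existsP; exists a; rewrite ha esym.
by move=> /existsP[a /andP[ha ea]]; split=> //; exists a; rewrite // esym.
Qed.

Lemma skeleton_connect x y w : x \notin s -> w != x -> skeleton w ->
  exists2 a, a \in s & connect (cut x y) w a.
Proof.
move=> xs wx /orP[ws|/off_spineP[_ _ [a ha ea]]]; first by exists w.
exists a => //; apply: cut_edge => //.
by apply: contraNneq xs => <-.
Qed.

(** Two such neighbours w, w' would give a walk from x to w that avoids the edge
    x w: go through w' to the spine, along the spine, and back to w. *)
Lemma skeleton_neighbor_unique x w w' :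
  x \notin s -> e x w -> e x w' -> skeleton w -> skeleton w' -> w = w'.
Proof.
move=> xs ew ew' hw hw'; apply/eqP; case: (boolP (w == w')) => // ww'.
have /negP[] := bridge ew.
have wx : w != x by rewrite eq_sym neq.
have w'x : w' != x by rewrite eq_sym neq.
have [a ha ca] := skeleton_connect w xs wx hw.
have [a' ha' ca'] := skeleton_connect w xs w'x hw'.
apply: (@connect_trans _ _ w').
  by apply: connect1; rewrite /cut /= ew' eqxx eq_sym (negPf ww') eq_sym (negPf wx).
apply: connect_trans ca' _.
by apply: connect_trans (spine_connect w xs ha' ha) _; rewrite cut_sym.
Qed.

Lemma degree_gt1P v :
  reflect (exists x y, [/\ e v x, e v y & x != y]) (1 < degree e v).
Proof.
apply: (iffP card_gt1P).
  by move=> [x [y []]]; rewrite !inE => *; exists x, y.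
by move=> [x [y [*]]]; exists x, y; rewrite !inE.
Qed.

Lemma near_spine v : v \notin s ->
  (exists2 a, a \in s & e v a) \/ exists z a, [/\ a \in s, e v z & e z a].
Proof.
move=> vs; have [_ /(_ v)[a ha [p [pp lp sp]]]] := spine.
case: p pp lp sp => [|z [|z' [|]]] //=.
- by move=> _ va; rewrite va ha in vs.
- by move=> /andP[ez _] za _; left; exists z => //; rewrite za.
- by move=> /and3P[ez ez' _] za _; right; exists z, z'; split=> //; rewrite za.
Qed.

(** Otherwise x is at distance 2 from the spine and has two neighbours y, z.
    Both x, through z, and y reach the spine by walks that avoid the edge x y,
    which contradicts [bridge]. *)
Lemma branching_off_spine x : x \notin s -> 1 < degree e x -> x \in off_spine e s.
Proof.
move=> xs dx; apply/off_spineP; split=> //; first by rewrite /pendant neq_ltn dx orbT.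
case: (near_spine xs) => // -[z [a [ha ez ea]]].
case: (boolP [exists b in s, e x b]) => [/existsP[b /andP[hb eb]]|/existsPn nx].
  by exists b.
have {}nx b : b \in s -> ~~ e x b by move=> hb; have := nx b; rewrite hb.
have [y ey yz] : exists2 y, e x y & y != z.
  have [u [v [eu ev uv]]] := degree_gt1P _ dx.
  case: (eqVneq u z) => [uz|]; last by exists u.
  by exists v => //; rewrite eq_sym -uz.
have ys : y \notin s by apply: contraL ey => /nx.
have xN c : c \in s -> c != x by apply: contraTneq => ->.
have zx : z != x by rewrite eq_sym neq.
have yx : y != x by rewrite eq_sym neq.
have cz : connect (cut x y) x a.
  apply: (@connect_trans _ _ z); last by apply: cut_edge => //; apply: xN.
  by apply: connect1; rewrite /cut /= ez (eq_sym z y) (negPf yz) (negPf zx) !andbF.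
suff [b hb cb] : exists2 b, b \in s & connect (cut x y) y b.
  have /negP[] := bridge ey; apply: connect_trans cz _.
  by apply: connect_trans (spine_connect y xs ha hb) _; rewrite cut_sym.
case: (near_spine ys) => [[b hb eb]|[z' [b [hb ez' eb]]]].
  by exists b => //; apply: cut_edge => //; apply: xN.
have z'x : z' != x by apply: contraTneq eb => ->; apply: nx.
exists b => //; apply: (@connect_trans _ _ z'); apply: cut_edge => //.
exact: xN.
Qed.

Variable x0 : T.
Local Notation n := (size s).
Local Notation v_ := (nth x0 s).

Let us : uniq s. Proof. by have [[]] := spine. Qed.

Lemma spine_consecutive i : i.+1 < n -> e (v_ i) (v_ i.+1).
Proof. by have [[_ /sortedP h _] _] := spine => hi; apply: h. Qed.

(** A chord would close a segment of the spine into a cycle. *)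
Lemma spine_chordless i j : i < j < n -> e (v_ i) (v_ j) -> j = i.+1.
Proof.
move=> /andP[ij jn] eij; apply/eqP; rewrite eqn_leq ij andbT leqNgt.
apply/negP => ij1.
have [[_ ps _] _] := spine.
set c := take (j - i).+1 (drop i s).
have sc : size c = (j - i).+1 by rewrite size_takel // size_drop; lia.
have uc : uniq c by rewrite take_uniq // drop_uniq.
have pc : sorted e c by apply: take_sorted; apply: drop_sorted.
have nc k : k < (j - i).+1 -> nth x0 c k = v_ (i + k).
  by move=> hk; rewrite nth_take // nth_drop.
have : cycle e c.
  move: (nc 0) (nc (j - i)) sc pc; case: (c) => [|a l] //= h0 hj [sl] pl.
  rewrite rcons_path pl (last_nth x0) sl hj // (h0 isT) addn0 subnKC 1?esym //.
  exact: ltnW.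
move=> cc; have := eacyc (c := c); rewrite /ucycle cc uc sc => /(_ isT); lia.
Qed.

Lemma spine_neighbors_le i : i < n ->
  #|[set x in neighbors e (v_ i) | x \in s]| <= (0 < i) + (i.+1 < n).
Proof.
move=> hi; pose l := (if 0 < i then [:: v_ i.-1] else [::]) ++
                     (if i.+1 < n then [:: v_ i.+1] else [::]).
have -> : (0 < i) + (i.+1 < n) = size l.
  by rewrite size_cat; case: ifP; case: ifP.
apply: leq_trans (card_size l); apply: subset_leq_card; apply/subsetP => x.
rewrite !inE mem_cat => /andP[ex /(nthP x0)[j hj xj]]; rewrite -{}xj in ex *.
case: (ltngtP i j) => [ij|ji|ij].
- have := spine_chordless _ ex; rewrite ij hj => /(_ isT) ->.
  by rewrite -(spine_chordless _ ex) ?ij // hj mem_head orbT.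
- rewrite esym in ex; have := spine_chordless _ ex; rewrite ji hi => /(_ isT) -> /=.
  by rewrite mem_head.
- by rewrite ij eirr in ex.
Qed.

Lemma sum_spine (F : T -> nat) : \sum_(v <- s) F v = \sum_(i < n) F (v_ i).
Proof. by rewrite (big_nth x0) big_mkord. Qed.

Lemma sum_spine_neighbors :
  \sum_(v <- s) #|[set x in neighbors e v | x \in s]| <= 2 * n.-1.
Proof.
rewrite sum_spine; apply: (@leq_trans (\sum_(i < n) ((0 < i) + (i.+1 < n)))).
  by apply: leq_sum => i _; apply: spine_neighbors_le.
rewrite big_split /= -(big_mkord xpredT (fun i => nat_of_bool (0 < i))).
rewrite -(big_mkord xpredT (fun i => nat_of_bool (i.+1 < n))).
case: (n) => [|m]; first by rewrite !big_nil.
rewrite [X in X + _]big_nat_recl //= [X in _ + X]big_nat_recr //= ltnn addn0 add0n.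
have le_m (F : nat -> bool) : \sum_(0 <= i < m) nat_of_bool (F i) <= m.
  apply: leq_trans (_ : \sum_(0 <= i < m) 1 <= m); last first.
    by rewrite sum_nat_const_nat subn0 muln1.
  by apply: leq_sum => i _; apply: leq_b1.
rewrite mul2n -addnn; apply: leq_add; last exact: le_m.
exact: (le_m (fun=> true)).
Qed.

Local Notation U := (off_spine e s).
Local Notation spine_set := [set x in s].

Lemma card_spine : #|spine_set| = n.
Proof. by rewrite cardsE; apply/card_uniqP. Qed.

Lemma sum_seq_set (F : T -> nat) : \sum_(v <- s) F v = \sum_(v in spine_set) F v.
Proof.
rewrite big_uniq //=; apply: eq_bigl => x; by rewrite inE.
Qed.

Lemma degree_split w :
  degree e w = #|[set x in neighbors e w | x \in s]| +
               #|[set x in neighbors e w | x \notin s]|.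
Proof.
rewrite /degree -(cardsID spine_set); congr (_ + _); apply: eq_card => x; rewrite !inE //.
by rewrite andbC.
Qed.

(** Double counting of the edges between the skeleton and the off-spine
    vertices, each of which has at most one neighbour in the skeleton. *)
Lemma sum_off_spine_neighbors :
  \sum_(w <- s) #|[set x in neighbors e w | x \notin s]| +
  \sum_(w in U) #|[set x in neighbors e w | x \notin s]| + n <= #|T|.
Proof.
have -> : \sum_(w <- s) #|[set x in neighbors e w | x \notin s]| +
  \sum_(w in U) #|[set x in neighbors e w | x \notin s]| =
  \sum_(w | skeleton w) #|[set x in neighbors e w | x \notin s]|.
  rewrite sum_seq_set [RHS](bigID (mem s)) /=; congr (_ + _); apply: eq_bigl => w.
  - by rewrite inE /skeleton /=; case: (w \in s); rewrite ?andbF.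
  - by rewrite /skeleton; case: (boolP (w \in s)) => //=; [rewrite inE => ->|rewrite andbT].
have -> : \sum_(w | skeleton w) #|[set x in neighbors e w | x \notin s]| =
   \sum_(x in ~: spine_set) #|[set w | skeleton w & e x w]|.
  under eq_bigr => w _ do rewrite -sum1dep_card.
  under [RHS]eq_bigr => w _ do rewrite -sum1dep_card.
  rewrite (exchange_big_dep (mem (~: spine_set))) /=; last first.
    by move=> w x _; rewrite !inE => /andP[].
  apply: eq_bigr => x; rewrite !inE => xs; apply: eq_bigl => w.
  by rewrite inE xs andbT esym.
rewrite -(cardsC spine_set) card_spine addnC leq_add2l -sum1_card; apply: leq_sum => x.
rewrite !inE => xs; apply/card_le1_eqP => w w'; rewrite !inE.
move=> /andP[hw ew] /andP[hw' ew']; exact: (skeleton_neighbor_unique xs).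
Qed.

Lemma spine_neighbors_off_spine w : w \in U ->
  #|[set x in neighbors e w | x \in s]| <= 1.
Proof.
move=> /off_spineP[ws _ _]; apply/card_le1_eqP => x y; rewrite !inE.
move=> /andP[ex xs] /andP[ey ys].
by apply: (skeleton_neighbor_unique ws); rewrite // /skeleton ?xs ?ys.
Qed.

Lemma sum_degrees :
  \sum_(v <- s) degree e v + \sum_(v in U) degree e v + n <=
  2 * n.-1 + #|U| + #|T|.
Proof.
under eq_bigr => w _ do rewrite degree_split.
under [X in _ + X + _ <= _]eq_bigr => w _ do rewrite degree_split.
rewrite !big_split /=.
have := sum_off_spine_neighbors; have := sum_spine_neighbors.
have : \sum_(w in U) #|[set x in neighbors e w | x \in s]| <= #|U|.
  by rewrite -sum1_card; apply: leq_sum => w; apply: spine_neighbors_off_spine.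
set a := \sum_(i in U) #|[set x in _ | x \in s]|.
set b := \sum_(i <- s) #|[set x in _ | x \in s]|.
set c := \sum_(i <- s) #|[set x in _ | x \notin s]|.
set d := \sum_(i in U) #|[set x in _ | x \notin s]|.
by clearbody a b c d; move: #|U| #|T| n; lia.
Qed.

Lemma sum_nonpendant_degrees :
  \sum_(v <- s) nonpendant_degree e v <= 2 * n.-1 + #|U|.
Proof.
apply: (@leq_trans (\sum_(v <- s) (#|[set x in neighbors e v | x \in s]| +
                                   #|[set x in U | e v x]|))).
  rewrite big_seq [X in _ <= X]big_seq; apply: leq_sum => v vs.
  apply: leq_trans (leq_card_setU _ _); apply: subset_leq_card.
  apply/subsetP => x; rewrite in_setU !in_set => /andP[ex px].
  rewrite ex !andbT /=; case: (boolP (x \in s)) => //= xs.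
  by rewrite px; apply/existsP; exists v; rewrite vs.
rewrite big_split leq_add ?sum_spine_neighbors // sum_seq_set.
under eq_bigr => w _ do rewrite -sum1dep_card.
rewrite (exchange_big_dep (mem U)) /=; last by move=> v x _ /andP[].
rewrite -sum1_card; apply: leq_sum => u uU.
rewrite sum1dep_card; apply: leq_trans (spine_neighbors_off_spine uU).
by apply: subset_leq_card; apply/subsetP => x; rewrite !inE esym => /andP[-> /andP[_ ->]].
Qed.

Hypothesis n_gt1 : 1 < n.

Definition spine_ends : {set T} :=
  [set w in s | ~~ pendant e w & (w == v_ 0) || (w == v_ n.-1)].
Definition anchors : {set T} := U :|: spine_ends.
Definition spine_parent (w : T) : T := odflt w [pick a | (a \in s) && e w a].
Definition off_child (w : T) : T := odflt w [pick x | (x \notin s) && e w x].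

Let skelU w : w \in U -> skeleton w. Proof. by rewrite /skeleton orbC => ->. Qed.
Let skelS w : w \in s -> skeleton w. Proof. by rewrite /skeleton => ->. Qed.

Lemma anchor_skeleton w : w \in anchors -> skeleton w.
Proof. by rewrite in_setU => /orP[/skelU //|]; rewrite inE => /andP[/skelS]. Qed.

Lemma anchor_spine_neighbor w : w \in anchors ->
  [/\ ~~ pendant e w, exists2 a, a \in s & e w a
    & #|[set x in neighbors e w | x \in s]| <= 1].
Proof.
rewrite in_setU => /orP[wU|].
  by have /off_spineP[_ pw ew] := wU; split=> //; apply: spine_neighbors_off_spine.
rewrite inE => /and3P[ws pw /orP[] /eqP ew]; split=> //.
- exists (v_ 1); first by rewrite mem_nth.
  by rewrite ew; apply: spine_consecutive.
- by rewrite ew; apply: leq_trans (spine_neighbors_le _) _; [lia|case: (1 < n)].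
- exists (v_ n.-2); first by rewrite mem_nth //; move: n n_gt1; lia.
  have n2 : n.-2.+1 = n.-1 by move: n n_gt1; lia.
  rewrite ew esym -n2; apply: spine_consecutive; rewrite n2.
  by move: n n_gt1; lia.
- rewrite ew; apply: leq_trans (spine_neighbors_le _) _.
    by rewrite prednK // ltnW.
  by rewrite prednK ?ltnn ?addn0 ?leq_b1 // ltnW.
Qed.

Lemma spine_parentP w :
  w \in anchors -> spine_parent w \in s /\ e w (spine_parent w).
Proof.
move=> /anchor_spine_neighbor[_ [a ha ea] _]; rewrite /spine_parent.
case: pickP => [x /andP[] //|/(_ a)]; by rewrite ha ea.
Qed.

Lemma off_childP w : w \in anchors -> off_child w \notin s /\ e w (off_child w).
Proof.
move=> /anchor_spine_neighbor[pw [a ha ea] hs]; rewrite /off_child.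
case: pickP => [x /andP[] //|h].
have : 0 < #|[set x in neighbors e w | x \notin s]|.
  have d0 : 0 < degree e w by apply/card_gt0P; exists a; rewrite inE.
  by move: pw d0 hs; rewrite /pendant degree_split; lia.
by move=> /card_gt0P[x]; rewrite !inE => /andP[ex xs]; have := h x; rewrite xs ex.
Qed.

Lemma off_child_anchor w w' : w \in anchors -> w' \in anchors ->
  e (off_child w) w' -> w = w'.
Proof.
move=> hw hw' ew'; have [xs ew] := off_childP hw; rewrite esym in ew.
apply: (skeleton_neighbor_unique xs ew ew'); exact: anchor_skeleton.
Qed.

Lemma off_child_inj : {in anchors &, injective off_child}.
Proof.
move=> w w' hw hw' eww'; apply: (off_child_anchor hw hw') => //.
by have [_] := off_childP hw'; rewrite esym eww'.
Qed.

Lemma card_anchors : #|anchors| <= #|U| + 2.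
Proof.
apply: leq_trans (leq_card_setU _ _) _; rewrite leq_add2l.
apply: leq_trans (_ : #|[set v_ 0; v_ n.-1]| <= 2); last by rewrite cards2; case: (_ != _).
by apply: subset_leq_card; apply/subsetP => w; rewrite !inE => /and3P[].
Qed.

Lemma card_spine_anchors : n + #|anchors| <= #|T|.
Proof.
rewrite -card_spine -(card_in_imset off_child_inj) -cardsUI.
rewrite (_ : spine_set :&: _ = set0) ?cards0 ?addn0 ?max_card //.
apply/setP => x; rewrite !inE; apply/andP => -[xs /imsetP[w hw ex]].
by have [/negP[]] := off_childP hw; rewrite -ex.
Qed.

(** The child of an off-spine non-pendant vertex w is pendant: otherwise it
    would also have a neighbour on the spine, besides w. *)
Lemma card_spine_off_spine : n + 2 * #|U| <= #|T|.
Proof.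
have UA w : w \in U -> w \in anchors by move=> wU; rewrite in_setU wU.
have injU : {in U &, injective off_child}.
  by move=> w w' /UA hw /UA hw'; apply: off_child_inj.
have SU : #|spine_set :|: U| = n + #|U|.
  rewrite cardsU card_spine (_ : spine_set :&: U = set0) ?cards0 ?subn0 //.
  apply/setP => x; rewrite in_set0 in_setI; apply/andP => -[].
  by rewrite inE => xs /off_spineP[/negP[]].
rewrite mul2n -addnn addnA -SU -(card_in_imset injU) -cardsUI.
rewrite (_ : _ :&: _ = set0) ?cards0 ?addn0 ?max_card //.
apply/setP => x; rewrite in_set0 in_setI; apply/andP => -[].
rewrite in_setU => xSU /imsetP[w wU ex].
have [xs ew] := off_childP (UA _ wU); rewrite -ex esym in xs ew.
have : x \in U by move: xSU; rewrite inE (negPf xs).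
move=> /off_spineP[_ _ [a ha ea]].
have wa := skeleton_neighbor_unique xs ew ea (skelU wU) (skelS ha).
by have /off_spineP[/negP[]] := wU; rewrite wa.
Qed.

Lemma v_eq i j : i < n -> j < n -> (v_ i == v_ j) = (i == j).
Proof. by move=> hi hj; rewrite nth_uniq. Qed.

Lemma interior_nonpendant i : 0 < i -> i.+1 < n -> ~~ pendant e (v_ i).
Proof.
case: i => // i _ hi; rewrite /pendant neq_ltn; apply/orP; right.
apply/degree_gt1P; exists (v_ i), (v_ i.+2); split.
- by rewrite esym; apply: spine_consecutive; apply: ltnW.
- exact: spine_consecutive.
- by rewrite v_eq // ?(ltnW (ltnW hi)) //; lia.
Qed.

Lemma interior_not_anchor i : 0 < i -> i.+1 < n -> v_ i \notin anchors.
Proof.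
move=> i0 hi; rewrite in_setU negb_or; apply/andP; split.
  by apply/off_spineP => -[/negP[]]; rewrite mem_nth // ltnW.
rewrite inE !v_eq; try by move: n hi i0; lia.
Qed.

Definition demand (i : nat) : nat := #|[set w in anchors | spine_parent w == v_ i]|.
Definition interior_neighbors (i : nat) : nat := (1 < i) + (i.+2 < n).

(** The anchors with parent v_i and the interior spine neighbours of v_i are
    distinct non-pendant neighbours of v_i: an interior spine vertex is not an
    anchor. *)
Lemma demand_le i : i < n ->
  demand i + interior_neighbors i <= nonpendant_degree e (v_ i).
Proof.
move=> hi; pose l := (if 1 < i then [:: v_ i.-1] else [::]) ++
                     (if i.+2 < n then [:: v_ i.+1] else [::]).
have lP x : x \in l -> exists j, [/\ 0 < j, j.+1 < n, x = v_ j & e (v_ i) x].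
  rewrite mem_cat => /orP[]; case: ifP => // h; rewrite inE => /eqP ->.
  - exists i.-1; split=> //; try by move: n hi h; lia.
    by rewrite esym -{2}(ltn_predK h); apply: spine_consecutive; rewrite (ltn_predK h).
  - by exists i.+1; split=> //; apply: spine_consecutive; apply: ltnW.
have ul : uniq l.
  rewrite /l; case: ifP => h; case: ifP => h' //=.
  by rewrite inE v_eq ?andbT //; move: n hi h h'; lia.
have -> : interior_neighbors i = size l.
  by rewrite size_cat /interior_neighbors; case: ifP; case: ifP.
rewrite /demand cardE -size_cat /nonpendant_degree cardE.
apply: uniq_leq_size.
  rewrite cat_uniq enum_uniq ul andbT; apply/hasPn => x /lP[j [j0 hj -> _]].
  by rewrite mem_enum inE (negPf (interior_not_anchor j0 hj)).
move=> x; rewrite mem_cat !mem_enum => /orP[|/lP[j [j0 hj xj ex]]]; rewrite in_set.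
  move=> /andP[xA /eqP <-]; have [_ ex] := spine_parentP xA.
  by rewrite !in_set esym ex; have [] := anchor_spine_neighbor xA.
by rewrite in_set ex xj interior_nonpendant.
Qed.

Lemma sum_demand : \sum_(i < n) demand i <= #|anchors|.
Proof.
under eq_bigr => i _ do rewrite /demand -sum1dep_card.
rewrite (exchange_big_dep (mem anchors)) /=; last by move=> i w _ /andP[].
rewrite -sum1_card; apply: leq_sum => w wA.
rewrite sum1dep_card; apply/card_le1_eqP => i j; rewrite !inE.
move=> /andP[_ /eqP hi] /andP[_]; rewrite hi => h.
by apply: ord_inj; apply/eqP; rewrite -v_eq // eq_sym.
Qed.

(** The position of the parent in the order [alternate]. *)
Definition row (w : T) : nat := alternate_pos n (index (spine_parent w) s).

Lemma row_lt w : w \in anchors -> row w < n.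
Proof. by move=> /spine_parentP[ws _]; apply: alternate_pos_lt; rewrite index_mem. Qed.

Lemma all2_map_nth (R : nat -> nat -> bool) lab (ws : seq T) (F : T -> nat) :
  all2 R lab (map F ws) -> size lab = size ws /\
  forall w t, t < size ws -> R (nth 0 lab t) (F (nth w ws t)).
Proof.
elim: lab ws => [|l ls IH] [|w ws] //= /andP[h /IH[-> h2]]; split=> // w' [|t] //=.
exact: h2.
Qed.

Lemma labeling_of_allocation (ws : seq T) c lab :
  perm_eq ws (enum anchors) -> allocation #|T| n (map row ws) c lab ->
  neighborhood_prime e.
Proof.
move=> pws [sc ucl hcl pc hlab].
have uw : uniq ws by rewrite (perm_uniq pws) enum_uniq.
have mw w : (w \in ws) = (w \in anchors) by rewrite (perm_mem pws) mem_enum.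
have [slab {}hlab] := all2_map_nth hlab.
pose sp := [seq v_ i | i <- alternate n].
have ssp : size sp = n by rewrite size_map size_alternate.
pose xs := sp ++ map off_child ws.
have spS x : x \in sp -> x \in s.
  by move=> /mapP[i]; rewrite mem_alternate => hi ->; apply: mem_nth.
have usp : uniq sp.
  rewrite map_inj_in_uniq ?uniq_alternate // => i j; rewrite !mem_alternate => hi hj h.
  by apply/eqP; rewrite -v_eq // h.
have uxs : uniq xs.
  rewrite cat_uniq usp map_inj_in_uniq ?uw ?andbT; last first.
    by move=> w w'; rewrite !mw; apply: off_child_inj.
  apply/hasPn => x /mapP[w]; rewrite mw => /off_childP[ws' _] ->.
  by apply: contra ws' => /spS.
have [] := @extend_labeling T xs (c ++ lab) uxs ucl _ hcl.
  by rewrite !size_cat ssp sc slab size_map.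
move=> f [finj fim fxs]; exists f; split=> //.
have fv i : i < n -> f (v_ i) = nth 0 c (alternate_pos n i).
  move=> hi; have hp := alternate_pos_lt hi.
  have -> : v_ i = nth x0 xs (alternate_pos n i).
    rewrite nth_cat ssp hp (nth_map 0) ?size_alternate //.
    by rewrite nth_alternate_pos.
  by rewrite fxs ?nth_cat ?sc ?hp // size_cat ssp ltn_addr.
have fw w : w \in anchors -> coprime (f (off_child w)) (f (spine_parent w)).
  move=> wA; have ww : w \in ws by rewrite mw.
  have ht : index w ws < size ws by rewrite index_mem.
  have -> : f (off_child w) = nth 0 lab (index w ws).
    have -> : off_child w = nth x0 xs (n + index w ws).
      rewrite nth_cat ssp ltnNge leq_addr /= addKn (nth_map w) //.
      by rewrite nth_index.
    rewrite fxs ?nth_cat ?sc; last by rewrite size_cat ssp size_map ltn_add2l.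
    by rewrite ltnNge leq_addr /= addKn.
  have [ps _] := spine_parentP wA.
  rewrite -[X in f X](nth_index x0 ps) fv ?index_mem //.
  by have := hlab w _ ht; rewrite nth_index.
have anchor_ok w : w \in anchors -> \big[gcdn/0]_(u in neighbors e w) f u = 1.
  move=> wA; have [_ h1] := off_childP wA; have [_ h2] := spine_parentP wA.
  by apply: (gcd_coprime _ _ (fw w wA)); rewrite inE.
move=> v dv; case: (boolP (v \in anchors)) => [/anchor_ok //|vA].
have vs : v \in s.
  apply: contraNT vA => vs.
  by rewrite in_setU (branching_off_spine vs dv).
have hi : index v s < n by rewrite index_mem.
have ev := nth_index x0 vs; move: (index v s) hi ev => i hi ev.
have pv : ~~ pendant e v by rewrite /pendant neq_ltn dv orbT.
have iint : (0 < i) && (i.+1 < n).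
  apply: contraNT vA => hii; rewrite in_setU; apply/orP; right.
  rewrite inE vs pv -ev !v_eq //=; first last.
  - exact: ltnW.
  - by rewrite prednK // ltnW.
  by clear -n_gt1 hi hii; move: n n_gt1 hi hii; lia.
case: i iint hi ev => // i /andP[_ hi2] hi ev.
have ci : coprime (f (v_ i)) (f (v_ i.+2)).
  rewrite !fv ?(ltnW hi) // alternate_posSS.
  apply: (sortedP 0 pc); rewrite sc -alternate_posSS.
  exact: alternate_pos_lt.
apply: (gcd_coprime _ _ ci); rewrite inE -ev.
  by rewrite esym; apply: spine_consecutive.
exact: spine_consecutive.
Qed.

Lemma row_demand i : i < n ->
  count (fun w => row w == alternate_pos n i) (enum anchors) <= demand i.
Proof.
move=> hi; rewrite -size_filter /demand cardE uniq_leq_size //.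
  by rewrite filter_uniq ?enum_uniq.
move=> w; rewrite mem_filter !mem_enum => /andP[/eqP hr wA]; rewrite inE wA /=.
have [ps _] := spine_parentP wA; rewrite -[spine_parent w](nth_index x0 ps).
have hw : index (spine_parent w) s < n by rewrite index_mem.
by rewrite -(nth_alternate_pos hi) -hr nth_alternate_pos.
Qed.

(** v_0 has position 0 and label 1, so its demand is not constrained. *)
Lemma neighborhood_prime_of_blocks b (F : nat -> nat) : 0 < b <= 10 ->
  (forall i, i < n -> b <= F i <= b + 2) ->
  (forall i, 0 < i < n -> demand i < F i) ->
  1 + \sum_(1 <= i < n) F i <= #|T| -> neighborhood_prime e.
Proof.
move=> hb hF hD hN.
pose ws0 := filter (fun w => row w == 0) (enum anchors).
pose ws1 := filter (predC (fun w => row w == 0)) (enum anchors).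
have pws : perm_eq (ws0 ++ ws1) (enum anchors) by rewrite perm_filterC.
have ea : alternate n = 0 :: behead (alternate n).
  by case: n n_gt1 => [|[|k]].
have sls : size (behead (alternate n)) = n.-1 by rewrite size_behead size_alternate.
have [||||||||c [lab hc]] := @allocation_blocks #|T| n b
   (map F (behead (alternate n))) (map row ws0) (map row ws1).
- by rewrite size_map sls prednK // ltnW.
- exact: hb.
- apply/allP => k /mapP[i /mem_behead]; rewrite mem_alternate => hi ->; exact: hF.
- have pb : perm_eq (behead (alternate n)) (iota 1 n.-1).
    rewrite -(perm_cons 0) -ea (_ : 0 :: iota 1 n.-1 = iota 0 n) ?perm_alternate //.
    by case: n n_gt1 => [|k].
  rewrite sumnE big_map (perm_big _ pb) /=.
  by move: hN; rewrite /index_iota subn1.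
- rewrite -map_cat size_map (perm_size pws) -cardE; exact: card_spine_anchors.
- by apply/allP => k /mapP[w]; rewrite mem_filter => /andP[/eqP -> _] ->.
- move=> k /mapP[w]; rewrite mem_filter mem_enum => /andP[/= w0 wA] ->.
  by rewrite lt0n w0 row_lt.
- move=> r; rewrite size_map => hr; rewrite (nth_map 0) // nth_behead.
  rewrite sls in hr; have rn : r.+1 < n by move: hr; clear; case: n.
  set i := nth 0 _ _.
  have hi : i < n by rewrite -mem_alternate mem_nth // size_alternate.
  have pi : alternate_pos n i = r.+1 by rewrite alternate_posK.
  have i0 : 0 < i by case: i pi {hi}.
  apply: leq_ltn_trans (hD i _); last by rewrite i0.
  apply: leq_trans (row_demand hi); rewrite count_map pi count_filter.
  by apply: sub_count => w /andP[].
by apply: labeling_of_allocation pws _; rewrite map_cat; apply: hc.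
Qed.

Lemma sum_interior_neighbors :
  2 * n <= \sum_(1 <= i < n) interior_neighbors i + (if n == 2 then 4 else 5).
Proof.
rewrite /interior_neighbors; have n2 := n_gt1.
case: (n) n2 => [|[|[|m]]] // _; first exact: leq_addl.
rewrite big_split /=.
set a := \sum_(1 <= i < _) _; set b := \sum_(1 <= i < _) _.
have le_sum x y (P : pred nat) : (forall i, x <= i < y -> P i) ->
    y - x <= \sum_(x <= i < y) nat_of_bool (P i).
  move=> hP; apply: (@leq_trans (\sum_(x <= i < y | x <= i < y) 1)).
    by rewrite -big_nat sum_nat_const_nat muln1.
  by rewrite [X in _ <= X]big_nat; apply: leq_sum => i /hP ->.
have ha : m.+1 <= a.
  rewrite /a big_ltn // add0n.
  by apply: leq_trans _ (le_sum 2 m.+3 (ltn 1) _) => // i /andP[].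
have hb : m <= b.
  have h := le_sum 1 m.+1 (fun i => i.+2 < m.+3); rewrite subn1 /= in h.
  rewrite /b (@big_cat_nat _ _ _ m.+1) //=; last by rewrite !ltnS !leqW.
  apply: leq_trans _ (leq_addr _ _).
  by apply: h => i /andP[].
lia.
Qed.

(** When N < 11 n, the hypothesis bounds d' by 11.  A block for v_i of length
    d' + 1 minus the number of interior neighbours of v_i is long enough by
    [demand_le], and these lengths add up to (n - 1) (d' - 1) + 3, or to d' + 1
    if n = 2, which leaves room for the label 1 as soon as d' >= 3.  For
    d' <= 2 the blocks are as short as possible, and there is room because all
    anchors have distinct children. *)
Theorem neighborhood_prime_of_long_spine :
  n * max_nonpendant_degree e s + 2 <= #|T| + n -> neighborhood_prime e.
Proof.
set d := max_nonpendant_degree e s => hd.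
have dle i : i < n -> demand i + interior_neighbors i <= d.
  move=> hi; apply: leq_trans (demand_le hi) _.
  by rewrite /d /max_nonpendant_degree (leq_bigmax_seq _ (mem_nth _ hi)).
have [nN|nN] := leqP (11 * n) #|T|.
  have [||||c [lab hc]] := @allocation_sparse #|T| n (map row (enum anchors)) => //.
  - rewrite size_map -cardE.
    have := card_anchors; have := card_spine_off_spine; clear.
    by move: #|U| #|anchors| n #|T|; lia.
  - by move=> k /mapP[w]; rewrite mem_enum => /row_lt ? ->.
  exact: labeling_of_allocation (perm_refl _) hc.
have [d2|d2] := leqP d 2.
  apply: (@neighborhood_prime_of_blocks 1 (fun i => (demand i).+1)) => //.
  - by move=> i /dle; lia.
  - have := card_spine_anchors; have := sum_demand.
    have n0 : 0 < n by apply: ltnW.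
    rewrite -(big_mkord xpredT demand) big_ltn // => h1 h2.
    rewrite (eq_bigr (fun i => demand i + 1)); last by move=> i _; rewrite addn1.
    rewrite big_split /= sum_nat_const_nat muln1.
    move: h1 h2 n0; clear; set a := \sum_(1 <= i < n) _.
    by clearbody a; move: n (demand 0) #|anchors| #|T|; lia.
have d12 : d <= 11.
  by move: hd nN n_gt1; clear; clearbody d; move: n #|T| => k m; nia.
apply: (@neighborhood_prime_of_blocks d.-1 (fun i => d.+1 - interior_neighbors i)).
- by move: d2 d12; clear; lia.
- by move=> i _; rewrite /interior_neighbors; move: d2; clear; lia.
- by move=> i /andP[_ /dle]; clear -d2; lia.
have hs := sum_interior_neighbors.
have E : \sum_(1 <= i < n) (d.+1 - interior_neighbors i) +
  \sum_(1 <= i < n) interior_neighbors i = n.-1 * d.+1.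
  rewrite -big_split /= (eq_bigr (fun=> d.+1)) ?sum_nat_const_nat ?subn1 //.
  by move=> i _; rewrite subnK // /interior_neighbors; move: d2; clear; lia.
move: hs E hd n_gt1 d2; clear; clearbody d.
set a := \sum_(1 <= i < n) (_ - _); set b := \sum_(1 <= i < n) _; clearbody a b.
move: n #|T| => [|[|[|k]]] m //=; rewrite ?mulSn ?mulnS; first by lia.
by move: (k * d) => kd; lia.
Qed.

End Spine.

(** * The theorem *)

(** Every off-spine vertex of degree at least 2 is adjacent to the only spine
    vertex, which gets label 1; the spine vertex itself needs two neighbours
    labelled 2 and 3. *)
Lemma neighborhood_prime_of_trivial_spine (T : finType) (e : rel T) (v0 : T) :
  symmetric e -> irreflexive e -> acyclic e -> is_spine e [:: v0] ->
  neighborhood_prime e.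
Proof.
move=> esym eirr eacyc spine.
pose nb := take 2 (enum (neighbors e v0)); pose xs := v0 :: nb.
have uxs : uniq xs.
  rewrite /= take_uniq ?enum_uniq // andbT; apply/negP => /mem_take.
  by rewrite mem_enum inE eirr.
have sxs : size xs <= #|T| by rewrite -(card_uniqP uxs) max_card.
have [||||f [finj fim fxs]] := @extend_labeling T xs (iota 1 (size xs)) => //.
- exact: iota_uniq.
- by rewrite size_iota.
- by move=> k; rewrite mem_iota; move: sxs; clear; lia.
have f0 : f v0 = 1 by rewrite -[v0]/(nth v0 xs 0) fxs.
exists f; split=> // v dv; case: (eqVneq v v0) => [ev|vv0].
  have snb : size nb = 2 by rewrite size_takel // -cardE -ev.
  have nbN k : k < 2 -> nth v0 nb k \in neighbors e v /\ f (nth v0 nb k) = k.+2.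
    move=> hk; split.
      by rewrite ev -mem_enum; apply: (mem_take (n0 := 2)); rewrite mem_nth ?snb.
    by rewrite -[nth v0 nb k]/(nth v0 xs k.+1) fxs ?nth_iota /= ?snb.
  have [h1 e1] := nbN 0 isT; have [h2 e2] := nbN 1 isT.
  by apply: (gcd_coprime h1 h2); rewrite e1 e2.
have vs : v \notin [:: v0] by rewrite inE.
have /off_spineP[//|_ _ [a]] := branching_off_spine esym eirr eacyc spine vs dv.
rewrite inE => /eqP -> ev.
have vN : v0 \in neighbors e v by rewrite inE.
by apply: (gcd_coprime vN vN); rewrite f0.
Qed.

Local Open Scope ring_scope.

Lemma sum_int_subr (I : Type) (r : seq I) (F : I -> nat) (c : int) :
  \sum_(i <- r) ((F i)%:Z - c) = (\sum_(i <- r) F i)%N%:Z - (size r)%:Z * c.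
Proof.
elim: r => [|i r IH]; first by rewrite !big_nil mul0r subr0.
by rewrite !big_cons IH /= PoszD -add1n PoszD; ring.
Qed.

Theorem proposition39 (T : finType) (e : rel T) (s : seq T)
    (hG : simple_graph e) (hL : lobster e) (hs : is_spine e s)
    (hsum :
      \sum_(v <- s) ((degree e v)%:Z - (2 : int))
        + \sum_(v in off_spine e s) ((degree e v)%:Z - (2 : int)) + (2 : int)
      >= \sum_(v <- s)
           ((max_nonpendant_degree e s)%:Z - (nonpendant_degree e v)%:Z)) :
  neighborhood_prime e.
Proof.
have [esym eirr] := hG; have [[_ _ eacyc] _] := hL.
case: s hs hsum => [|v0 [|v1 s']] hs hsum; first by case: hs => -[].
  exact: neighborhood_prime_of_trivial_spine hs.
set s := [:: v0, v1 & s'] in hs hsum.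
apply: (@neighborhood_prime_of_long_spine T e s esym eirr eacyc hs v0 isT).
have := sum_degrees esym eirr eacyc hs v0.
have := sum_nonpendant_degrees esym eirr eacyc hs v0.
move: hsum; rewrite -[\sum_(v in _) _]big_enum !sum_int_subr -cardE big_enum /=.
under eq_bigr => v _ do rewrite -opprB.
rewrite sumrN sum_int_subr opprB.
rewrite -[size s]/((size s').+2) /=.
set d := max_nonpendant_degree e s.
set a := (\sum_(v <- s) degree e v)%N; set b := (\sum_(v in _) degree e v)%N.
set c := (\sum_(v <- s) nonpendant_degree e v)%N.
move: #|off_spine e s| #|T| (size s').+1; clearbody a b c d; clear => k N n.
by rewrite -PoszM; move: (n.+1 * d)%N; lia.
Qed.
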